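(* For $M<\pi^2$, $M\neq 0$, define $$f(M)=\begin{cases}\dfrac{m^{2}}{1-\cos\left(\frac{m}{2}\right)}, & M=m^2,\ m\in(0,\pi),\\[8pt] \dfrac{2m^{2}e^{\frac{m}{2}}}{1+e^{m}-2e^{\frac{m}{2}}}, & M=-m^2<0,\ m\in(0,\infty).\end{cases}$$ Let $M<\pi^2$, $M\neq 0$, let $\delta_2\in(M,f(M))$ and let $\delta_1\in\mathbb{R}$. Then $G_{M,\delta_1,\delta_2}(t,s)<0$ for all $(t,s)\in[0,1]\times[0,1]$ if and only if $$|\delta_1|<2\,(M-\delta_2)\,G_{M,0,\delta_2}\left(1,\tfrac12\right).$$
   Context: Let $I=[0,1]$. For real parameters $M,\delta_1,\delta_2$ consider the problem $$u''(t)+M\,u(t)=\sigma(t),\ t\in I,\qquad u(0)-u(1)=\delta_1\int_0^1u(s)\,ds,\qquad u'(0)-u'(1)=\delta_2\int_0^1u(s)\,ds,$$ with $\sigma\in C(I)$. If this problem has a unique solution $u\in C^2(I)$ for every $\sigma\in C(I)$ (this happens exactly when $\delta_2\ne M$ and $M\neq 4k^2\pi^2$ for all integers $k\ge 1$), its Green's function $G_{M,\delta_1,\delta_2}$ is the unique continuous function on $I\times I$ such that for every $\sigma\in C(I)$ the unique solution is $u(t)=\int_0^1G_{M,\delta_1,\delta_2}(t,s)\,\sigma(s)\,ds$. $G_{M,0,\delta_2}$ denotes the case $\delta_1=0$. *)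

(* Defs.v *)
From Stdlib Require Import Reals.
From Coquelicot Require Import Coquelicot.

Open Scope R_scope.

Definition unit_itv (t : R) : Prop := 0 <= t <= 1.

Definition unit_square (p : R * R) : Prop :=
  unit_itv (fst p) /\ unit_itv (snd p).

(* [u], restricted to I = [0,1], is a C^2(I) solution of
     u'' + M u = sigma on I,  u(0) - u(1) = d1 int_0^1 u,
     u'(0) - u'(1) = d2 int_0^1 u.
   [D_in] is the derivative relative to I, hence one-sided at 0 and 1;
   [du] and [ddu] are u' and u''.  Values of [u] outside I are irrelevant. *)
Definition is_solution (M d1 d2 : R) (sigma u : R -> R) : Prop :=
  exists du ddu : R -> R,
    (forall t, unit_itv t -> D_in u du unit_itv t) /\
    (forall t, unit_itv t -> D_in du ddu unit_itv t) /\
    continuous_on unit_itv ddu /\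
    (forall t, unit_itv t -> ddu t + M * u t = sigma t) /\
    u 0 - u 1 = d1 * RInt u 0 1 /\
    du 0 - du 1 = d2 * RInt u 0 1.

(* The equivalence says that, for each sigma in C(I), the problem has exactly
   one solution on I, namely t |-> int_0^1 G(t,s) sigma(s) ds.  Only the
   values of [G] on I x I matter. *)
Definition is_Green (M d1 d2 : R) (G : R -> R -> R) : Prop :=
  continuous_on unit_square (fun p : R * R => G (fst p) (snd p)) /\
  forall sigma : R -> R, continuous_on unit_itv sigma ->
  forall u : R -> R,
    is_solution M d1 d2 sigma u <->
    (forall t, unit_itv t -> u t = RInt (fun s => G t s * sigma s) 0 1).

(* Meaningful for M < PI^2, M <> 0. *)
Definition f_bound (M : R) : R :=
  if Rlt_dec 0 M then
    let m := sqrt M in m ^ 2 / (1 - cos (m / 2))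
  else
    let m := sqrt (- M) in
    2 * m ^ 2 * exp (m / 2) / (1 + exp m - 2 * exp (m / 2)).

(* Main.v *)
Require Import Defs.
From Stdlib Require Import Reals Lra.
From Coquelicot Require Import Coquelicot.

Open Scope R_scope.

(** The Green's function has a closed form, and its sign can be read off that
form at the two points t = 0 and t = 1.

Let C, S be the solutions of y'' + M y = 0 with C(0) = 1, C'(0) = 0 and
S(0) = 0, S'(0) = 1: trigonometric for M > 0, hyperbolic for M < 0.  Every
later argument uses only identities common to both cases, collected in
[cosine_sine_pair].  The periodic problem has the Green's function
g(t,s) = C(1/2 - |t-s|) / (2 M S(1/2)).  The homogeneous solutions
b(t) = C(1/2 - t) / (2 M S(1/2)) and a = b' have unit jumps
b'(0) - b'(1) = 1 and a(0) - a(1) = 1, their other jumps being 0.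
A solution u with source sigma is thus the periodic response to sigma plus
(d1 a + d2 b) int u, and integrating the equation over [0,1] gives
(M - d2) int u = int sigma.  Hence
G(t,s) = g(t,s) + (d1 a(t) + d2 b(t)) / (M - d2),
which is [green_kernel].  Green's identity makes this rigorous
([green_representation]).  Applied to the source
sigma = G(t,.) - green_kernel(t,.), it yields int sigma^2 = 0, which
identifies any Green's function with the closed form on the square
([green_function_unique]).

Put V(x) = (1 - C(x)) / M = 2 S(x/2)^2 >= 0.  Multiplying G by the positive
number 2 S(1/2) (d2 - M) gives, with x = 1/2 - t and y = 1/2 - |t-s|,
d2 V(x) - d1 S(x) - 1 - (d2 - M) V(y).
For each t some s has |t-s| = 1/2, that is y = 0, and this is the worst s;
so G < 0 means d2 V(x) - d1 S(x) < 1 for all |x| <= 1/2.  The two endpoints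
x = 1/2 and x = -1/2 give the condition |d1| S(1/2) + d2 V(1/2) < 1, and
[endpoint_bound_interior] shows that they imply all the others.  The same
formula with d1 = 0 at (1, 1/2) says that 2 (M - d2) G_{M,0,d2}(1, 1/2) is
(1 - d2 V(1/2)) / S(1/2), so this condition is the bound on |d1|. *)

(** * Calculus on the unit interval with one-sided derivatives *)

(** Composing with this retraction of the line onto [0,1] turns continuity
relative to the interval into two-sided continuity, the form in which the
theory of the integral wants it. *)
Definition clamp (x : R) : R := Rmax 0 (Rmin 1 x).

Lemma clamp_itv x : unit_itv (clamp x).
Proof.
unfold clamp, unit_itv, Rmax, Rmin.
repeat destruct Rle_dec; lra.
Qed.

Lemma clamp_id x : unit_itv x -> clamp x = x.
Proof.
unfold clamp, unit_itv, Rmax, Rmin; intros Hx.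
repeat destruct Rle_dec; lra.
Qed.

Lemma clamp_lipschitz x y : Rabs (clamp y - clamp x) <= Rabs (y - x).
Proof.
unfold clamp, Rmax, Rmin.
repeat destruct Rle_dec; unfold Rabs; repeat destruct Rcase_abs; lra.
Qed.

Lemma continuous_on_clamp (f : R -> R) x :
  continuous_on unit_itv f -> continuous (fun y => f (clamp y)) x.
Proof.
intros Hf.
apply (filterlim_comp _ _ _ clamp f _ (within unit_itv (locally (clamp x)))).
- intros P [e He]; exists e; intros y Hy.
  apply He; [|apply clamp_itv].
  exact (Rle_lt_trans _ _ _ (clamp_lipschitz x y) Hy).
- exact (Hf _ (clamp_itv x)).
Qed.

Lemma clamp_continuous_on (f : R -> R) :
  (forall x, continuous (fun y => f (clamp y)) x) -> continuous_on unit_itv f.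
Proof.
intros Hf; apply (continuous_on_ext _ (fun y => f (clamp y))).
- now intros x Hx; rewrite clamp_id.
- now apply continuous_on_forall.
Qed.

Lemma continuous_on_minus (f g : R -> R) :
  continuous_on unit_itv f -> continuous_on unit_itv g ->
  continuous_on unit_itv (fun x => f x - g x).
Proof.
intros Hf Hg; apply clamp_continuous_on; intros x.
exact (continuous_minus (V := R_NormedModule) _ _ x
  (continuous_on_clamp f x Hf) (continuous_on_clamp g x Hg)).
Qed.

Lemma continuous_on_mult (f g : R -> R) :
  continuous_on unit_itv f -> continuous_on unit_itv g ->
  continuous_on unit_itv (fun x => f x * g x).
Proof.
intros Hf Hg; apply clamp_continuous_on; intros x.
exact (continuous_mult (K := R_AbsRing) _ _ x
  (continuous_on_clamp f x Hf) (continuous_on_clamp g x Hg)).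
Qed.

Lemma D_in_continuous_on (f df : R -> R) :
  (forall t, unit_itv t -> D_in f df unit_itv t) -> continuous_on unit_itv f.
Proof.
intros Hf x Hx P [e He].
destruct (cont_deriv _ _ _ _ (Hf x Hx) e (cond_pos e)) as [d [Hd0 Hd]].
exists (mkposreal d Hd0); intros y Hy Iy; apply He.
destruct (Req_dec x y) as [<-|Hxy]; [apply ball_center|].
apply Hd; split; [now split|exact Hy].
Qed.

Lemma D_in_is_derive (f df : R -> R) x :
  0 < x < 1 -> D_in f df unit_itv x -> is_derive f x (df x).
Proof.
intros Hx Hf; apply is_derive_Reals; intros e He.
destruct (Hf e He) as [d [Hd0 Hd]].
assert (Hp : 0 < Rmin d (Rmin x (1 - x))) by (repeat apply Rmin_pos; lra).
exists (mkposreal _ Hp); simpl; intros h Hh Hlt.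
assert (Hm1 := Rmin_l d (Rmin x (1 - x))).
assert (Hm2 := Rmin_r d (Rmin x (1 - x))).
assert (Hm3 := Rmin_l x (1 - x)).
assert (Hm4 := Rmin_r x (1 - x)).
assert (Hh2 := Rabs_def2 _ _ Hlt).
replace ((f (x + h) - f x) / h) with ((f (x + h) - f x) / (x + h - x))
  by (now replace (x + h - x) with h by ring).
apply (Hd (x + h)); split.
- split; [split|]; lra.
- simpl; unfold Rdist; replace (x + h - x) with h by ring; lra.
Qed.

(** Fundamental theorem of calculus for derivatives relative to [0,1].  After
clamping, F minus a primitive of f is continuous on the line and has zero
derivative inside the interval, so the mean value theorem applies: it asks for
differentiability at interior points only, where the one-sided notion is the
ordinary one. *)
Lemma is_RInt_D_in (F f : R -> R) a b :
  (forall t, unit_itv t -> D_in F f unit_itv t) -> continuous_on unit_itv f ->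
  0 <= a -> a <= b -> b <= 1 -> is_RInt f a b (F b - F a).
Proof.
intros HF Hf Ha Hab Hb.
assert (Hfc : forall x, continuous (fun y => f (clamp y)) x)
  by (intros x; now apply continuous_on_clamp).
set (P := fun x => RInt (fun y => f (clamp y)) a x).
assert (HP : forall x, is_RInt (fun y => f (clamp y)) a x (P x)).
{ intros x; apply (RInt_correct (V := R_CompleteNormedModule)).
  now apply (ex_RInt_continuous (V := R_CompleteNormedModule)). }
assert (dP : forall x, is_derive P x (f (clamp x))).
{ intros x.
  apply (is_derive_RInt (V := R_NormedModule) (fun y => f (clamp y)) P a x).
  - now apply filter_forall.
  - apply Hfc. }
destruct (MVT_gen (fun x => F (clamp x) - P x) a b (fun _ => 0))
  as [c [_ Hc]].
- rewrite Rmin_left, Rmax_right by assumption; intros x Hx.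
  replace 0 with (minus (f x) (f (clamp x)))
    by (rewrite clamp_id by (split; lra); apply (minus_eq_zero (f x))).
  apply (is_derive_minus (V := R_NormedModule) (fun y => F (clamp y)) P);
    [|apply dP].
  apply (is_derive_ext_loc F).
  + assert (Hp : 0 < Rmin (x - a) (b - x)) by (apply Rmin_pos; lra).
    exists (mkposreal _ Hp); intros y Hy.
    destruct (Rabs_def2 _ _ Hy) as [Hy1 Hy2].
    unfold minus, plus, opp in Hy1, Hy2; simpl in Hy1, Hy2.
    assert (Hm1 := Rmin_l (x - a) (b - x)).
    assert (Hm2 := Rmin_r (x - a) (b - x)).
    rewrite clamp_id by (split; lra); reflexivity.
  + apply D_in_is_derive; [lra|]; apply HF; split; lra.
- intros x _; apply continuity_pt_filterlim.
  apply (continuous_minus (V := R_NormedModule) (fun y => F (clamp y)) P).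
  + apply continuous_on_clamp; now apply (D_in_continuous_on F f).
  + apply (ex_derive_continuous (V := R_NormedModule)); eexists; apply dP.
- rewrite !clamp_id in Hc by (split; lra).
  assert (HPa : P a = 0) by exact (RInt_point a _).
  replace (F b - F a) with (P b) by lra.
  apply (is_RInt_ext (fun y => f (clamp y))); [|apply HP].
  rewrite Rmin_left, Rmax_right by assumption; intros x Hx.
  rewrite clamp_id by (split; lra); reflexivity.
Qed.

Lemma is_derive_D_in (f df : R -> R) x :
  is_derive f x (df x) -> D_in f df unit_itv x.
Proof.
intros Hf; apply is_derive_Reals, derivable_pt_lim_D_in in Hf.
revert Hf; apply limit1_imp; intros y [_ Hy]; now split.
Qed.

Lemma is_derive_continuous_on (f df : R -> R) :
  (forall x, is_derive f x (df x)) -> continuous_on unit_itv f.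
Proof.
intros Hf; apply (D_in_continuous_on f df).
intros t _; now apply is_derive_D_in.
Qed.

Lemma D_in_derivative_eq (f df dg : R -> R) D x :
  df x = dg x -> D_in f df D x -> D_in f dg D x.
Proof. now unfold D_in; intros ->. Qed.

(** If k'' + M k = 0 then (k u' - k' u)' = k (u'' + M u). *)
Lemma is_RInt_green_identity M (u du ddu k dk : R -> R) a b :
  (forall t, unit_itv t -> D_in u du unit_itv t) ->
  (forall t, unit_itv t -> D_in du ddu unit_itv t) ->
  continuous_on unit_itv ddu ->
  (forall x, is_derive k x (dk x)) ->
  (forall x, is_derive dk x (- M * k x)) ->
  0 <= a -> a <= b -> b <= 1 ->
  is_RInt (fun s => k s * (ddu s + M * u s)) a b
    ((k b * du b - dk b * u b) - (k a * du a - dk a * u a)).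
Proof.
intros Hu Hdu Hddu Hk Hdk Ha Hab Hb.
apply (is_RInt_D_in (fun s => k s * du s - dk s * u s)); auto.
- intros t Ht.
  assert (HW := Dminus _ _ _ _ _ t
    (Dmult _ _ _ _ _ _ (is_derive_D_in k dk t (Hk t)) (Hdu t Ht))
    (Dmult _ _ _ _ _ _
       (is_derive_D_in dk (fun x => - M * k x) t (Hdk t)) (Hu t Ht))).
  revert HW; apply D_in_derivative_eq; cbv beta; ring.
- apply (continuous_on_ext _
    (fun s => k s * ddu s - (- M * k s) * u s)).
  { intros; simpl; ring. }
  repeat (apply continuous_on_minus || apply continuous_on_mult); auto;
    try (now apply (is_derive_continuous_on _ _ Hk));
    try (now apply (D_in_continuous_on _ _ Hu)).
  apply continuous_on_forall; intros; apply continuous_const.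
Qed.

Lemma RInt_square_eq0 (f : R -> R) s :
  continuous_on unit_itv f -> is_RInt (fun x => f x * f x) 0 1 0 ->
  unit_itv s -> f s = 0.
Proof.
intros Hf H0 Hs.
set (w := fun x => f (clamp x) * f (clamp x)).
assert (Hw : forall x, continuous w x).
{ intros x; apply (continuous_on_clamp (fun y => f y * f y)).
  now apply continuous_on_mult. }
assert (Hex : forall a b, ex_RInt w a b).
{ intros a b; now apply (ex_RInt_continuous (V := R_CompleteNormedModule)). }
assert (Hw0 : forall x, 0 <= w x) by (intros x; apply Rle_0_sqr).
assert (HI : RInt w 0 1 = 0).
{ apply is_RInt_unique; revert H0; apply is_RInt_ext.
  rewrite Rmin_left, Rmax_right by lra; intros x Hx; unfold w.
  now rewrite clamp_id by (split; lra). }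
destruct (Req_dec (f s) 0) as [E|Hne]; [exact E|exfalso].
assert (Hws : 0 < w s).
{ unfold w; rewrite clamp_id by assumption; now apply Rsqr_pos_lt. }
destruct (Hw s (fun y => 0 < y)) as [d Hd].
{ now apply (open_gt 0). }
assert (Hd0 := cond_pos d); unfold unit_itv in Hs.
set (a := Rmax 0 (s - d / 2)); set (b := Rmin 1 (s + d / 2)).
assert (Ha : 0 <= a /\ s - d / 2 <= a /\ a <= s /\ (a < s \/ a = 0)).
{ unfold a, Rmax; destruct Rle_dec; lra. }
assert (Hb : b <= 1 /\ b <= s + d / 2 /\ s <= b /\ (s < b \/ b = 1)).
{ unfold b, Rmin; destruct Rle_dec; lra. }
assert (Hpos : 0 < RInt w a b).
{ apply RInt_gt_0; [lra| |auto].
  intros x Hx; apply Hd.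
  apply Rabs_def1; unfold minus, plus, opp; simpl; lra. }
assert (H1 := RInt_ge_0 w 0 a ltac:(lra) (Hex _ _) (fun x _ => Hw0 x)).
assert (H2 := RInt_ge_0 w b 1 ltac:(lra) (Hex _ _) (fun x _ => Hw0 x)).
assert (E1 := RInt_Chasles w 0 a b (Hex _ _) (Hex _ _)).
assert (E2 := RInt_Chasles w 0 b 1 (Hex _ _) (Hex _ _)).
unfold plus in E1, E2; simpl in E1, E2; lra.
Qed.

(** * The fundamental pair of y'' + M y = 0 *)

(** What the trigonometric and hyperbolic solutions have in common.  The last
field is where M < PI^2 enters: it keeps the interval [0, 1/2] inside the
first increasing branch of the sine. *)
Record cosine_sine_pair (M : R) (C S : R -> R) : Prop := {
  derive_C : forall x, is_derive C x (- M * S x);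
  derive_S : forall x, is_derive S x (C x);
  C_even : forall x, C (- x) = C x;
  S_odd : forall x, S (- x) = - S x;
  S_minus : forall x y, S (x - y) = S x * C y - C x * S y;
  C_half : forall x, 1 - C x = 2 * M * (S (x / 2) * S (x / 2));
  S_increasing : forall x y, 0 <= x -> x < y -> y <= 1 / 2 -> S x < S y
}.

Lemma trigonometric_pair m :
  0 < m < PI ->
  cosine_sine_pair (m * m) (fun x => cos (m * x)) (fun x => sin (m * x) / m).
Proof.
intros Hm; split.
- intros x; auto_derive; [trivial|field; lra].
- intros x; auto_derive; [trivial|field; lra].
- intros x; rewrite Ropp_mult_distr_r_reverse; apply cos_neg.
- intros x; rewrite Ropp_mult_distr_r_reverse, sin_neg; field; lra.
- intros x y; rewrite Rmult_minus_distr_l, sin_minus; field; lra.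
- intros x; replace (m * x) with (2 * (m * (x / 2))) by field.
  rewrite cos_2a_sin; field; lra.
- intros x y Hx Hxy Hy; apply Rmult_lt_compat_r.
  + apply Rinv_0_lt_compat; lra.
  + apply sin_increasing_1; nra.
Qed.

Lemma hyperbolic_pair m :
  0 < m ->
  cosine_sine_pair (- (m * m))
    (fun x => cosh (m * x)) (fun x => sinh (m * x) / m).
Proof.
intros Hm; split.
- intros x; unfold cosh, sinh; auto_derive; [trivial|field; lra].
- intros x; unfold cosh, sinh; auto_derive; [trivial|field; lra].
- intros x; unfold cosh; rewrite Ropp_mult_distr_r_reverse, Ropp_involutive.
  field.
- intros x; unfold sinh; rewrite Ropp_mult_distr_r_reverse, Ropp_involutive.
  field; lra.
- intros x y; unfold cosh, sinh.
  replace (- (m * (x - y))) with (- (m * x) + m * y) by ring.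
  replace (m * (x - y)) with (m * x + - (m * y)) by ring.
  rewrite !exp_plus; field; lra.
- intros x; unfold cosh, sinh.
  replace (- (m * x)) with (- (m * (x / 2)) + - (m * (x / 2))) by field.
  replace (m * x) with (m * (x / 2) + m * (x / 2)) by field.
  rewrite !exp_plus.
  assert (E : exp (m * (x / 2)) * exp (- (m * (x / 2))) = 1)
    by (rewrite <- exp_plus, Rplus_opp_r; apply exp_0).
  (* The constant 1 of the half-angle formula is exp (m x/2) exp (- m x/2). *)
  transitivity (exp (m * (x / 2)) * exp (- (m * (x / 2)))
    - (exp (m * (x / 2)) * exp (m * (x / 2)) +
       exp (- (m * (x / 2))) * exp (- (m * (x / 2)))) / 2).
  { now rewrite E. }
  field; lra.
- intros x y Hx Hxy Hy; apply Rmult_lt_compat_r.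
  + now apply Rinv_0_lt_compat.
  + apply sinh_lt; nra.
Qed.

Lemma cosine_sine_pair_exists M :
  M < PI ^ 2 -> M <> 0 -> exists C S, cosine_sine_pair M C S.
Proof.
intros HM HM0; assert (HPI := PI_RGT_0).
destruct (Rlt_dec 0 M) as [HMp|HMn].
- assert (Hs := sqrt_lt_R0 M HMp); assert (E := sqrt_sqrt M ltac:(lra)).
  do 2 eexists; rewrite <- E at 1; apply trigonometric_pair.
  split; [assumption|nra].
- assert (HMp : 0 < - M) by lra.
  assert (Hs := sqrt_lt_R0 (- M) HMp).
  assert (E := sqrt_sqrt (- M) ltac:(lra)).
  do 2 eexists; replace M with (- (sqrt (- M) * sqrt (- M))) at 1 by lra.
  now apply hyperbolic_pair.
Qed.

Lemma S_at_0 M C S : cosine_sine_pair M C S -> S 0 = 0.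
Proof.
intros HCS; assert (H := S_odd _ _ _ HCS 0); rewrite Ropp_0 in H; lra.
Qed.

Lemma S_nonneg M C S x :
  cosine_sine_pair M C S -> 0 <= x <= 1 / 2 -> 0 <= S x.
Proof.
intros HCS Hx; rewrite <- (S_at_0 _ _ _ HCS).
destruct (Req_dec 0 x) as [<-|Hn]; [apply Rle_refl|].
left; apply (S_increasing _ _ _ HCS); lra.
Qed.

Lemma S_half_pos M C S : cosine_sine_pair M C S -> 0 < S (1 / 2).
Proof.
intros HCS; rewrite <- (S_at_0 _ _ _ HCS).
apply (S_increasing _ _ _ HCS); lra.
Qed.

Lemma S_monotone M C S x y :
  cosine_sine_pair M C S -> 0 <= x -> x <= y -> y <= 1 / 2 -> S x <= S y.
Proof.
intros HCS Hx Hxy Hy; destruct (Req_dec x y) as [<-|Hn]; [apply Rle_refl|].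
left; apply (S_increasing _ _ _ HCS); lra.
Qed.

(** * The Green's function in closed form *)

(** The first term solves the periodic problem.  The factors of d1 and d2 solve
the homogeneous equation, with a unit jump between 0 and 1 in the value and in
the derivative respectively.  Division by M - d2 comes from
(M - d2) int u = int sigma. *)
Definition green_kernel (M d1 d2 : R) (C S : R -> R) (t s : R) : R :=
  C (1 / 2 - Rabs (t - s)) / (2 * M * S (1 / 2)) +
  (d1 * (S (1 / 2 - t) / (2 * S (1 / 2))) +
   d2 * (C (1 / 2 - t) / (2 * M * S (1 / 2)))) / (M - d2).

Lemma green_kernel_continuous M d1 d2 C S t :
  cosine_sine_pair M C S ->
  continuous_on unit_itv (green_kernel M d1 d2 C S t).
Proof.
intros HCS; apply continuous_on_forall; intros s _.
apply (continuous_plus (V := R_NormedModule)); [|apply continuous_const].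
apply (continuous_mult (K := R_AbsRing)); [|apply continuous_const].
apply (continuous_comp (fun s => 1 / 2 - Rabs (t - s)) C).
- apply (continuous_minus (V := R_NormedModule)); [apply continuous_const|].
  apply (continuous_comp (fun s => t - s) Rabs).
  + apply (continuous_minus (V := R_NormedModule));
      [apply continuous_const|apply continuous_id].
  + apply continuous_Rabs.
- apply (ex_derive_continuous (V := R_NormedModule)); eexists.
  apply (derive_C _ _ _ HCS).
Qed.

(** On each side of s = t the periodic part of the kernel is a smooth solution
of the homogeneous equation in s.  Green's identity on [0,t] and on [t,1]
leaves boundary terms: those at t add up to u(t), because the s-derivative of
the kernel jumps by one there, and those at 0 and 1 combine into the jumps of
u and u', which the boundary conditions express through the integral of u. *)
Lemma green_representation M d1 d2 C S sigma u t :
  M <> 0 -> M <> d2 -> cosine_sine_pair M C S ->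
  is_solution M d1 d2 sigma u -> unit_itv t ->
  is_RInt (fun s => green_kernel M d1 d2 C S t s * sigma s) 0 1 (u t).
Proof.
intros HM Hd HCS [du [ddu [Hu [Hdu [Hddu [Hode [Hb1 Hb2]]]]]]] [Ht0 Ht1].
assert (HS := S_half_pos _ _ _ HCS).
assert (dC : forall x, Derive C x = - M * S x)
  by (intros; apply is_derive_unique, (derive_C _ _ _ HCS)).
assert (dS : forall x, Derive S x = C x)
  by (intros; apply is_derive_unique, (derive_S _ _ _ HCS)).
assert (eC : forall x, ex_derive C x)
  by (intros x; eexists; apply (derive_C _ _ _ HCS)).
assert (eS : forall x, ex_derive S x)
  by (intros x; eexists; apply (derive_S _ _ _ HCS)).
set (I := RInt u 0 1) in *.
assert (HI : is_RInt u 0 1 I).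
{ apply (RInt_correct (V := R_CompleteNormedModule)).
  apply (ex_RInt_ext (V := R_CompleteNormedModule) (fun s => u (clamp s))).
  - rewrite Rmin_left, Rmax_right by lra; intros x Hx.
    now rewrite clamp_id by (split; lra).
  - apply (ex_RInt_continuous (V := R_CompleteNormedModule)); intros z _.
    apply continuous_on_clamp; now apply (D_in_continuous_on u du). }
(* Integrating the equation ties the unknown mean of u to the source. *)
assert (Hsig : is_RInt sigma 0 1 ((M - d2) * I)).
{ apply (is_RInt_ext (fun s => ddu s + M * u s)).
  - rewrite Rmin_left, Rmax_right by lra; intros x Hx.
    apply Hode; split; lra.
  - replace ((M - d2) * I) with ((du 1 - du 0) + M * I) by lra.
    apply (is_RInt_plus (V := R_NormedModule)).
    + apply is_RInt_D_in; auto; lra.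
    + now apply (is_RInt_scal (V := R_NormedModule)). }
assert (Hleft := is_RInt_green_identity M u du ddu
  (fun s => C (1 / 2 - t + s) / (2 * M * S (1 / 2)))
  (fun s => - S (1 / 2 - t + s) / (2 * S (1 / 2))) 0 t Hu Hdu Hddu
  ltac:(intros x; auto_derive; [auto|rewrite dC; field; lra])
  ltac:(intros x; auto_derive; [auto|rewrite dS; field; lra])
  ltac:(lra) Ht0 Ht1).
assert (Hright := is_RInt_green_identity M u du ddu
  (fun s => C (1 / 2 + t - s) / (2 * M * S (1 / 2)))
  (fun s => S (1 / 2 + t - s) / (2 * S (1 / 2))) t 1 Hu Hdu Hddu
  ltac:(intros x; auto_derive; [auto|rewrite dC; unfold Rminus; field; lra])
  ltac:(intros x; auto_derive; [auto|rewrite dS; unfold Rminus; field; lra])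
  Ht0 Ht1 ltac:(lra)).
cbv beta in Hleft, Hright.
set (c := (d1 * (S (1 / 2 - t) / (2 * S (1 / 2))) +
   d2 * (C (1 / 2 - t) / (2 * M * S (1 / 2)))) / (M - d2)).
apply (is_RInt_ext (fun s =>
  C (1 / 2 - Rabs (t - s)) / (2 * M * S (1 / 2)) * sigma s + c * sigma s)).
{ intros x _; unfold green_kernel; fold c; simpl; ring. }
set (A := C (1 / 2 - t) / (2 * M * S (1 / 2))).
set (B := S (1 / 2 - t) / (2 * S (1 / 2))).
replace (u t) with
  ((u t - A * (du 0 - du 1) - B * (u 0 - u 1)) + c * ((M - d2) * I)).
2: { rewrite Hb1, Hb2; unfold A, B, c; field; lra. }
apply (is_RInt_plus (V := R_NormedModule));
  [|now apply (is_RInt_scal (V := R_NormedModule))].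
replace (u t - A * (du 0 - du 1) - B * (u 0 - u 1)) with
  (plus (C (1 / 2 - t + t) / (2 * M * S (1 / 2)) * du t -
          - S (1 / 2 - t + t) / (2 * S (1 / 2)) * u t -
          (C (1 / 2 - t + 0) / (2 * M * S (1 / 2)) * du 0 -
           - S (1 / 2 - t + 0) / (2 * S (1 / 2)) * u 0))
        (C (1 / 2 + t - 1) / (2 * M * S (1 / 2)) * du 1 -
           S (1 / 2 + t - 1) / (2 * S (1 / 2)) * u 1 -
           (C (1 / 2 + t - t) / (2 * M * S (1 / 2)) * du t -
            S (1 / 2 + t - t) / (2 * S (1 / 2)) * u t))).
2: { unfold plus; simpl.
  replace (1 / 2 - t + t) with (1 / 2) by ring.
  replace (1 / 2 - t + 0) with (1 / 2 - t) by ring.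
  replace (1 / 2 + t - t) with (1 / 2) by ring.
  replace (1 / 2 + t - 1) with (- (1 / 2 - t)) by field.
  rewrite (C_even _ _ _ HCS), (S_odd _ _ _ HCS).
  unfold A, B; field; lra. }
apply (is_RInt_Chasles (V := R_NormedModule)) with t.
- revert Hleft; apply is_RInt_ext.
  rewrite Rmin_left, Rmax_right by lra; intros x Hx.
  rewrite Hode by (split; lra); rewrite Rabs_pos_eq by lra.
  now replace (1 / 2 - (t - x)) with (1 / 2 - t + x) by ring.
- revert Hright; apply is_RInt_ext.
  rewrite Rmin_left, Rmax_right by lra; intros x Hx.
  rewrite Hode by (split; lra); rewrite Rabs_minus_sym, Rabs_pos_eq by lra.
  now replace (1 / 2 - (x - t)) with (1 / 2 + t - x) by ring.
Qed.

(** The problem is solvable for every continuous source, the integral of G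
against it being a solution by definition.  Take as source the difference of
G t and the closed form: against it both represent the same value u(t), so its
square has zero integral. *)
Lemma green_function_unique M d1 d2 C S G t s :
  M <> 0 -> M <> d2 -> cosine_sine_pair M C S -> is_Green M d1 d2 G ->
  unit_itv t -> unit_itv s -> G t s = green_kernel M d1 d2 C S t s.
Proof.
intros HM Hd HCS [HGc HG] Ht Hs.
assert (HGt : continuous_on unit_itv (G t)).
{ intros x Hx.
  apply (filterlim_comp _ _ _ (fun y => (t, y)) (fun p => G (fst p) (snd p))
    _ (within unit_square (locally (t, x)))).
  - intros P [e He]; exists e; intros y Hy Iy; apply He.
    + split; [apply ball_center|exact Hy].
    + now split.
  - apply (HGc (t, x)); now split. }
assert (Hdiff : continuous_on unit_itv
  (fun x => G t x - green_kernel M d1 d2 C S t x)).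
{ apply continuous_on_minus; [exact HGt|now apply green_kernel_continuous]. }
set (sigma := fun x => G t x - green_kernel M d1 d2 C S t x) in *.
set (u := fun r => RInt (fun x => G r x * sigma x) 0 1).
assert (Hsol : is_solution M d1 d2 sigma u) by (now apply HG).
assert (H1 := green_representation _ _ _ _ _ _ _ t HM Hd HCS Hsol Ht).
assert (H2 : is_RInt (fun x => G t x * sigma x) 0 1 (u t)).
{ apply (RInt_correct (V := R_CompleteNormedModule)).
  apply (ex_RInt_ext (V := R_CompleteNormedModule)
    (fun x => G t (clamp x) * sigma (clamp x))).
  - rewrite Rmin_left, Rmax_right by lra; intros x Hx.
    now rewrite clamp_id by (split; lra).
  - apply (ex_RInt_continuous (V := R_CompleteNormedModule)); intros z _.
    apply (continuous_on_clamp (fun x => G t x * sigma x)).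
    now apply continuous_on_mult. }
assert (H0 : sigma s = 0).
{ apply RInt_square_eq0; [exact Hdiff| |exact Hs].
  assert (E : minus (u t) (u t) = 0) by (apply (minus_eq_zero (u t))).
  rewrite <- E at 2.
  apply (is_RInt_ext (fun x => minus (G t x * sigma x)
    (green_kernel M d1 d2 C S t x * sigma x))).
  - intros x _; unfold sigma, minus, plus, opp; simpl; ring.
  - exact (is_RInt_minus (V := R_NormedModule) _ _ _ _ _ _ H2 H1). }
unfold sigma in H0; lra.
Qed.

(** * The sign of the Green's function *)

(** Writing C(z) = 1 - 2 M S(z/2)^2 cancels the division by M, so that what
remains has the same signs in the trigonometric and hyperbolic cases. *)
Lemma green_kernel_scaled M d1 d2 C S t s :
  M <> 0 -> M <> d2 -> cosine_sine_pair M C S ->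
  2 * S (1 / 2) * (d2 - M) * green_kernel M d1 d2 C S t s =
  2 * d2 * (S ((1 / 2 - t) / 2) * S ((1 / 2 - t) / 2)) - d1 * S (1 / 2 - t) - 1
  - 2 * (d2 - M) * (S ((1 / 2 - Rabs (t - s)) / 2) *
      S ((1 / 2 - Rabs (t - s)) / 2)).
Proof.
intros HM Hd HCS; assert (HS := S_half_pos _ _ _ HCS).
unfold green_kernel.
replace (C (1 / 2 - t))
  with (1 - 2 * M * (S ((1 / 2 - t) / 2) * S ((1 / 2 - t) / 2)))
  by (rewrite <- (C_half _ _ _ HCS); ring).
replace (C (1 / 2 - Rabs (t - s))) with (1 - 2 * M *
  (S ((1 / 2 - Rabs (t - s)) / 2) * S ((1 / 2 - Rabs (t - s)) / 2)))
  by (rewrite <- (C_half _ _ _ HCS); ring).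
field; lra.
Qed.

(** For d2 >= 0 the left-hand side increases with x.  For d2 < 0, which forces
M < 0, put V(x) = 2 S(x/2)^2; the claim follows from
S(x) / (1 - d2 V(x)) <= S(h) / (1 - d2 V(h)) with h = 1/2.  Indeed
M (S(x) V(h) - S(h) V(x)) = S(x) - S(h) + S(h - x) by the subtraction formula,
and 0 < d2 / M < 1. *)
Lemma endpoint_bound_interior M C S a d2 x :
  cosine_sine_pair M C S -> M <> 0 -> M < d2 -> 0 <= a ->
  a * S (1 / 2) + 2 * d2 * (S (1 / 2 / 2) * S (1 / 2 / 2)) < 1 ->
  0 <= x <= 1 / 2 ->
  a * S x + 2 * d2 * (S (x / 2) * S (x / 2)) < 1.
Proof.
intros HCS HM Hd Ha Hend Hx.
assert (HSh := S_half_pos _ _ _ HCS).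
assert (HSx := S_nonneg _ _ _ x HCS Hx).
assert (HSxh : S x <= S (1 / 2)) by (apply (S_monotone _ _ _ _ _ HCS); lra).
destruct (Rle_lt_dec 0 d2) as [Hd2|Hd2].
- assert (Hq0 := S_nonneg _ _ _ (x / 2) HCS ltac:(lra)).
  assert (Hq : S (x / 2) <= S (1 / 2 / 2))
    by (apply (S_monotone _ _ _ _ _ HCS); lra).
  assert (H1 := Rmult_le_compat_l a _ _ Ha HSxh).
  assert (H2 := Rmult_le_compat_l d2 _ _ Hd2
    (Rmult_le_compat _ _ _ _ Hq0 Hq0 Hq Hq)).
  lra.
- assert (HSd := S_nonneg _ _ _ (1 / 2 - x) HCS ltac:(lra)).
  rewrite (S_minus _ _ _ HCS) in HSd.
  assert (Ex := C_half _ _ _ HCS x); assert (Eh := C_half _ _ _ HCS (1 / 2)).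
  set (vx := S (x / 2) * S (x / 2)) in *.
  set (vh := S (1 / 2 / 2) * S (1 / 2 / 2)) in *.
  assert (Hvx : 0 <= vx) by apply Rle_0_sqr.
  assert (key : S x * (1 - 2 * d2 * vh) <= S (1 / 2) * (1 - 2 * d2 * vx)).
  { replace (C x) with (1 - 2 * M * vx) in HSd by lra.
    replace (C (1 / 2)) with (1 - 2 * M * vh) in HSd by lra.
    set (D := 2 * (S x * vh - S (1 / 2) * vx)).
    assert (HD : M * D >= S x - S (1 / 2)) by (unfold D; lra).
    assert (- d2 * D <= S (1 / 2) - S x).
    { destruct (Rle_lt_dec D 0); nra. }
    unfold D in *; lra. }
  destruct HSx as [HSx|HSx].
  + assert (a * S (1 / 2) * S x < S (1 / 2) * (1 - 2 * d2 * vx)) by nra.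
    assert (Hlt : S (1 / 2) * (a * S x) < S (1 / 2) * (1 - 2 * d2 * vx))
      by lra.
    apply Rmult_lt_reg_l in Hlt; lra.
  + rewrite <- HSx; nra.
Qed.

Lemma green_kernel_antipodal M d1 d2 C S t s :
  M <> 0 -> M <> d2 -> cosine_sine_pair M C S -> Rabs (t - s) = 1 / 2 ->
  2 * S (1 / 2) * (d2 - M) * green_kernel M d1 d2 C S t s =
  2 * d2 * (S ((1 / 2 - t) / 2) * S ((1 / 2 - t) / 2))
  - d1 * S (1 / 2 - t) - 1.
Proof.
intros HM Hd HCS Hts; rewrite green_kernel_scaled by assumption; rewrite Hts.
replace ((1 / 2 - 1 / 2) / 2) with 0 by field.
rewrite (S_at_0 _ _ _ HCS); ring.
Qed.

(** Necessity comes from the points (0, 1/2) and (1, 1/2), where x = 1/2 - t is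
1/2 and -1/2 and the two signs of d1 S(x) produce |d1|.  For sufficiency, drop
the term - (d2 - M) V(y) <= 0 and use the parities of S to replace x by |x|. *)
Lemma green_kernel_negative_iff M d1 d2 C S :
  M <> 0 -> M < d2 -> cosine_sine_pair M C S ->
  (forall t s, unit_itv t -> unit_itv s -> green_kernel M d1 d2 C S t s < 0)
  <->
  Rabs d1 * S (1 / 2) + 2 * d2 * (S (1 / 2 / 2) * S (1 / 2 / 2)) < 1.
Proof.
intros HM Hd HCS; assert (HS := S_half_pos _ _ _ HCS).
assert (Hfac : 0 < 2 * S (1 / 2) * (d2 - M))
  by (apply Rmult_lt_0_compat; lra).
split.
- intros Hneg.
  assert (E0 := green_kernel_antipodal M d1 d2 C S 0 (1 / 2) HM ltac:(lra) HCS
    ltac:(rewrite Rabs_minus_sym, Rabs_pos_eq; lra)).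
  assert (E1 := green_kernel_antipodal M d1 d2 C S 1 (1 / 2) HM ltac:(lra) HCS
    ltac:(rewrite Rabs_pos_eq; lra)).
  assert (N0 := Rmult_lt_compat_l _ _ _ Hfac
    (Hneg 0 (1 / 2) ltac:(split; lra) ltac:(split; lra))).
  assert (N1 := Rmult_lt_compat_l _ _ _ Hfac
    (Hneg 1 (1 / 2) ltac:(split; lra) ltac:(split; lra))).
  rewrite Rmult_0_r in N0, N1; rewrite E0 in N0; rewrite E1 in N1.
  replace ((1 / 2 - 1) / 2) with (- (1 / 2 / 2)) in N1 by field.
  replace (1 / 2 - 1) with (- (1 / 2)) in N1 by field.
  rewrite !(S_odd _ _ _ HCS) in N1; rewrite !Rminus_0_r in N0.
  unfold Rabs; destruct Rcase_abs; lra.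
- intros Hend t s [Ht0 Ht1] Hs.
  apply (Rmult_lt_reg_l _ _ _ Hfac).
  rewrite Rmult_0_r, green_kernel_scaled by (assumption || lra).
  set (x := 1 / 2 - t).
  assert (Hx : 0 <= Rabs x <= 1 / 2)
    by (unfold x, Rabs; destruct Rcase_abs; lra).
  assert (Hint := endpoint_bound_interior M C S (Rabs d1) d2 (Rabs x)
    HCS HM Hd (Rabs_pos d1) Hend Hx).
  assert (Habs : - d1 * S x <= Rabs d1 * S (Rabs x)).
  { apply Rle_trans with (1 := Rle_abs _).
    rewrite Rabs_mult, Rabs_Ropp.
    apply Rmult_le_compat_l; [apply Rabs_pos|].
    assert (HSx := S_nonneg _ _ _ _ HCS Hx).
    rewrite <- (Rabs_pos_eq _ HSx) at 1.
    unfold Rabs at 3; destruct (Rcase_abs x); [|lra].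
    rewrite (S_odd _ _ _ HCS), Rabs_Ropp; lra. }
  assert (Hsq : S (Rabs x / 2) * S (Rabs x / 2) = S (x / 2) * S (x / 2)).
  { unfold Rabs; destruct Rcase_abs; [|reflexivity].
    replace (- x / 2) with (- (x / 2)) by field.
    rewrite (S_odd _ _ _ HCS); ring. }
  rewrite Hsq in Hint.
  set (y := (1 / 2 - Rabs (t - s)) / 2).
  assert (Hy : 0 <= (d2 - M) * (S y * S y))
    by (apply Rmult_le_pos; [lra|apply Rle_0_sqr]).
  lra.
Qed.

Theorem theorem5p4 (M d1 d2 : R) (G G0 : R -> R -> R)
  (HM : M < PI ^ 2) (HM0 : M <> 0)
  (Hd2 : M < d2 < f_bound M)
  (HG : is_Green M d1 d2 G)
  (HG0 : is_Green M 0 d2 G0) :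
  (forall t s : R, unit_itv t -> unit_itv s -> G t s < 0) <->
  Rabs d1 < 2 * (M - d2) * G0 1 (1 / 2).
Proof.
destruct (cosine_sine_pair_exists M HM HM0) as [C [S HCS]].
destruct Hd2 as [Hd _]; assert (Hne : M <> d2) by lra.
assert (HS := S_half_pos _ _ _ HCS).
assert (Hthreshold : S (1 / 2) * (2 * (M - d2) * G0 1 (1 / 2)) =
  1 - 2 * d2 * (S (1 / 2 / 2) * S (1 / 2 / 2))).
{ rewrite (green_function_unique M 0 d2 C S G0) by (assumption || split; lra).
  assert (E := green_kernel_antipodal M 0 d2 C S 1 (1 / 2) HM0 Hne HCS
    ltac:(rewrite Rabs_pos_eq; lra)).
  replace ((1 / 2 - 1) / 2) with (- (1 / 2 / 2)) in E by field.
  rewrite (S_odd _ _ _ HCS (1 / 2 / 2)) in E; lra. }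
apply iff_trans with
  (forall t s, unit_itv t -> unit_itv s -> green_kernel M d1 d2 C S t s < 0).
- split; intros H t s Ht Hs; specialize (H t s Ht Hs);
    now rewrite (green_function_unique M d1 d2 C S G) in *.
- rewrite (green_kernel_negative_iff M d1 d2 C S HM0 Hd HCS).
  split; intros H.
  + apply (Rmult_lt_reg_l _ _ _ HS); lra.
  + apply (Rmult_lt_compat_l _ _ _ HS) in H; lra.
Qed.
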